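(* Let $f:\mathbb{R}^n\to\mathbb{R}$ be a gradient-Lipschitz-continuous function with modulus $L>0$. Assume that $f$ achieves its minimum $\min f$ and that $\mathrm{crit}\,f=\mathrm{Arg}\min f\neq\emptyset$. Let $\epsilon>0$ be a fixed constant and set $\Omega=\{x:f(x)\le\min f+\epsilon\}$. Let $\{x_k\}_{k\ge0}$ be generated by the gradient descent method $x_{k+1}=x_k-h\nabla f(x_k)$ with $h=\frac1L$ and $x_0\in\Omega$. (i) If $f$ satisfies the $(\nabla f,\nu,\Omega)$-(cor-EB) condition with $\nu<L$, then $$f(x_{k+1})-\min f\le\left(1-\left(\frac{\nu}{L}\right)^2\right)(f(x_k)-\min f),\quad k\ge0.$$ (ii) If, in addition to the assumption of (i), $f$ is convex, then $$d^2(x_{k+1},\mathrm{Arg}\min f)\le\left(1-\frac{\nu}{L}\right)d^2(x_k,\mathrm{Arg}\min f),\quad k\ge0.$$ (iii) Conversely, if $f$ is convex and if, starting from an arbitrary initial point $x_0\in\Omega$, the gradient descent method with $h=\frac1L$ converges linearly in the sense that $d^2(x_{k+1},\mathrm{Arg}\min f)\le\tau\, d^2(x_k,\mathrm{Arg}\min f)$ for all $k\ge0$, with a constant $\tau\in(0,1)$, then $f$ satisfies the $(\nabla f,\nu,\Omega)$-(cor-EB) condition with $\nu=L(1-\sqrt\tau)^2$.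
   Context: $f$ is gradient-Lipschitz-continuous with modulus $L>0$ if it is differentiable and $\|\nabla f(x)-\nabla f(y)\|\le L\|x-y\|$ for all $x,y\in\mathbb{R}^n$. $\mathrm{crit}\,f=\{x:\nabla f(x)=0\}$; $\mathrm{Arg}\min f$ is the set of global minimizers of $f$ over $\mathbb{R}^n$; $d(x,Q)=\inf_{y\in Q}\|x-y\|$; $\mathcal{P}_f(x)$ is the set of points $u\in\mathrm{crit}\,f$ minimizing $\|x-u\|$. The $(\nabla f,\nu,\Omega)$-(cor-EB) condition (with $\nu>0$) means: for all $x\in\Omega$, $\inf_{x_p\in\mathcal{P}_f(x)}\langle\nabla f(x),x-x_p\rangle\ge\nu\, d^2(x,\mathrm{crit}\,f)$. *)

(* Defs.v *)
From HB Require Import structures.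
From mathcomp Require Import all_boot all_order all_algebra.
From mathcomp Require Import all_classical all_reals all_analysis.
Set Implicit Arguments.
Unset Strict Implicit.
Unset Printing Implicit Defensive.
Import Order.TTheory GRing.Theory Num.Theory.
Import numFieldNormedType.Exports.
Local Open Scope classical_set_scope.
Local Open Scope ring_scope.

(* The library norm `|x| on 'rV[R]_n is the sup norm, hence the explicit
   Euclidean structure.  [differentiable] may still be taken with respect to
   the library norm, all norms on R^n being equivalent. *)
Definition dotv (R : realType) (n : nat) (u v : 'rV[R]_n) : R :=
  \sum_(i < n) u 0 i * v 0 i.

Definition enorm (R : realType) (n : nat) (u : 'rV[R]_n) : R :=
  Num.sqrt (dotv u u).

(* The real-valued [inf] makes this meaningful for nonempty Q only. *)
Definition dist (R : realType) (n : nat) (x : 'rV[R]_n) (Q : set 'rV[R]_n) : R :=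
  inf [set enorm (x - y) | y in Q].

Definition grad (R : realType) (n : nat) (f : 'rV[R]_n -> R) (x : 'rV[R]_n) :
    'rV[R]_n :=
  \row_(i < n) 'D_(delta_mx 0 i) f x.

Definition grad_lipschitz (R : realType) (n : nat) (f : 'rV[R]_n -> R) (L : R) :
    Prop :=
  (forall x, differentiable f x) /\
  (forall x y, enorm (grad f x - grad f y) <= L * enorm (x - y)).

Definition crit (R : realType) (n : nat) (f : 'rV[R]_n -> R) : set 'rV[R]_n :=
  [set x | grad f x = 0].

Definition Argmin (R : realType) (n : nat) (f : 'rV[R]_n -> R) : set 'rV[R]_n :=
  [set x | forall y, f x <= f y].

Definition achieves_min (R : realType) (n : nat) (f : 'rV[R]_n -> R) (m : R) :
    Prop :=
  (exists x, f x = m) /\ (forall x, m <= f x).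

Definition proj_crit (R : realType) (n : nat) (f : 'rV[R]_n -> R)
    (x : 'rV[R]_n) : set 'rV[R]_n :=
  [set u | crit f u /\ forall v, crit f v -> enorm (x - u) <= enorm (x - v)].

Definition cor_EB (R : realType) (n : nat) (f : 'rV[R]_n -> R) (nu : R)
    (Omega : set 'rV[R]_n) : Prop :=
  0 < nu /\
  forall x, Omega x ->
    ((nu * dist x (crit f) ^+ 2)%:E <=
       ereal_inf [set (dotv (grad f x) (x - xp))%:E | xp in proj_crit f x])%E.

Definition sublevel (R : realType) (n : nat) (f : 'rV[R]_n -> R) (c : R) :
    set 'rV[R]_n :=
  [set x | f x <= c].

Definition gradient_descent (R : realType) (n : nat) (f : 'rV[R]_n -> R) (h : R)
    (x : nat -> 'rV[R]_n) : Prop :=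
  forall k, x k.+1 = x k - h *: grad f (x k).

(* Main.v *)
Require Import Defs.
From HB Require Import structures.
From mathcomp Require Import all_boot all_order all_algebra.
From mathcomp Require Import all_classical all_reals all_analysis.
From mathcomp Require Import ring lra.
Import Order.TTheory GRing.Theory Num.Theory.
Import numFieldNormedType.Exports.
Local Open Scope classical_set_scope.
Local Open Scope ring_scope.

(** Every part follows from a one-step estimate at a point [x], with
    [g = grad f x], [p] a critical point nearest to [x], [d = |x - p|] and
    [x+ = x - g / L].

    Since the gradient is [L]-Lipschitz, [f] stays within [L / 2 * |v|^2] of its
    linearization ([descent_upper], [descent_lower]). The upper bound gives the
    decrease [f x+ <= f x - |g|^2 / (2 L)], so iterates never leave a sublevel
    set, and, centred at [p], the growth bound [f x - fmin <= L / 2 * d^2].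

    (i) The error bound and Cauchy-Schwarz give [nu * d <= |g|]. Combined with
    the growth bound this makes the decrease at least
    [(nu / L)^2 * (f x - fmin)].

    (ii) For convex [f] the gradient is cocoercive, [|g|^2 / L <= <g, x - p>]
    ([grad_cocoercive]). Expanding [|x+ - p|^2], one of the two copies of
    [<g, x - p> / L] absorbs [|g|^2 / L^2] and the error bound turns the other
    into [nu / L * d^2].

    (iii) The distance to [crit f] drops by at most [|x - x+| = |g| / L] in a
    step. If it is contracted by [sqrt tau], then [|g| / L >= (1 - sqrt tau) d],
    and cocoercivity bounds [<g, x - p>] below by [L * (|g| / L)^2].

    The error bound is an infimum over the nearest critical points, hence void
    if there are none. Nearest points exist because [crit f = Argmin f] is
    nonempty and closed, by compactness ([closed_proximinal]). *)

(** * Euclidean geometry of row vectors *)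

Section EuclideanStructure.
Context {R : realType} {n : nat}.
Implicit Types (u v w x y z : 'rV[R]_n) (a : R) (Q : set 'rV[R]_n).

Lemma dotvC u v : dotv u v = dotv v u.
Proof. by apply: eq_bigr => i _; rewrite mulrC. Qed.

Lemma dotvDl u v w : dotv (u + v) w = dotv u w + dotv v w.
Proof. by rewrite -big_split; apply: eq_bigr => i _; rewrite mxE mulrDl. Qed.

Lemma dotvZl a u v : dotv (a *: u) v = a * dotv u v.
Proof. by rewrite mulr_sumr; apply: eq_bigr => i _; rewrite mxE mulrA. Qed.

Lemma dotvNl u v : dotv (- u) v = - dotv u v.
Proof. by rewrite -scaleN1r dotvZl mulN1r. Qed.

Lemma dotvDr u v w : dotv u (v + w) = dotv u v + dotv u w.
Proof. by rewrite dotvC dotvDl !(dotvC _ u). Qed.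

Lemma dotvZr a u v : dotv u (a *: v) = a * dotv u v.
Proof. by rewrite dotvC dotvZl dotvC. Qed.

Lemma dotvNr u v : dotv u (- v) = - dotv u v.
Proof. by rewrite dotvC dotvNl dotvC. Qed.

Definition dotvE := (dotvDl, dotvDr, dotvNl, dotvNr, dotvZl, dotvZr).

Lemma dotvv_ge0 u : 0 <= dotv u u.
Proof. by apply: sumr_ge0 => i _; rewrite -expr2 sqr_ge0. Qed.

Lemma enorm_ge0 u : 0 <= enorm u.
Proof. exact: sqrtr_ge0. Qed.

Lemma sqr_enorm u : enorm u ^+ 2 = dotv u u.
Proof. by rewrite sqr_sqrtr ?dotvv_ge0. Qed.

Lemma enormN u : enorm (- u) = enorm u.
Proof. by rewrite /enorm dotvNl dotvNr opprK. Qed.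

Lemma enormZ a u : 0 <= a -> enorm (a *: u) = a * enorm u.
Proof.
by move=> a0; rewrite /enorm dotvZl dotvZr mulrA -expr2 sqrtrM ?sqr_ge0//
  sqrtr_sqr ger0_norm.
Qed.

(** The discriminant argument, with the vector [c u - b v], where
    [b = <u, v>] and [c = <v, v>]. *)
Lemma dotv_le_enorm u v : dotv u v <= enorm u * enorm v.
Proof.
set a := dotv u u; set b := dotv u v; set c := dotv v v.
have : 0 <= dotv (c *: u - b *: v) (c *: u - b *: v) by exact: dotvv_ge0.
rewrite !dotvE (dotvC v u) -/a -/b -/c => H.
have a0 : 0 <= a := dotvv_ge0 u.
have c0 : 0 <= c := dotvv_ge0 v.
suff bac : b ^+ 2 <= a * c.
  apply: le_trans (ler_norm b) _.
  by rewrite -sqrtr_sqr /enorm -sqrtrM// ler_sqrt ?mulr_ge0.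
have [c_gt0|] := ltP 0 c.
  have {}H : 0 <= c * (a * c - b ^+ 2) by apply: le_trans H _; nra.
  by move: H; rewrite pmulr_rge0// subr_ge0.
move=> c_le0; have c_eq0 : c = 0 by apply/eqP; rewrite eq_le c_le0.
(* A vector of zero norm is zero, as each square in the sum vanishes. *)
have v0 i : v 0 i = 0.
  apply/eqP; rewrite -sqrf_eq0 expr2.
  move/eqP: c_eq0; rewrite psumr_eq0 => [/allP/(_ i)|j _].
    by rewrite mem_index_enum; exact.
  by rewrite -expr2 sqr_ge0.
have -> : b = 0 by apply: big1 => i _; rewrite v0 mulr0.
by rewrite expr0n mulr_ge0.
Qed.

Lemma enormD u v : enorm (u + v) <= enorm u + enorm v.
Proof.
rewrite -ler_sqr ?nnegrE ?addr_ge0 ?enorm_ge0// sqr_enorm !dotvE (dotvC v u).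
rewrite -!sqr_enorm sqrrD; have := dotv_le_enorm u v; lra.
Qed.

Lemma sqr_enormBZ a u v :
  enorm (u - a *: v) ^+ 2 = enorm u ^+ 2 - 2 * a * dotv v u + a ^+ 2 * enorm v ^+ 2.
Proof. by rewrite !sqr_enorm !dotvE (dotvC u v); ring. Qed.

Lemma coord_le_enorm u i : `|u 0 i| <= enorm u.
Proof.
rewrite -sqrtr_sqr ler_sqrt ?dotvv_ge0// /dotv (bigD1 i)//= -expr2 lerDl.
by apply: sumr_ge0 => j _; rewrite -expr2 sqr_ge0.
Qed.

Lemma continuous_enormB x : continuous (fun y => enorm (x - y)).
Proof.
have cc i : continuous (fun y : 'rV[R]_n => (x - y) 0 i).
  under eq_fun do rewrite !mxE.
  by move=> y; apply: continuousB; [exact: cst_continuous | exact: coord_continuous].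
have cdot : continuous (fun y => dotv (x - y) (x - y)).
  apply: continuous_big => [|i _]; first exact: add_continuous.
  by move=> y; apply: continuousM; exact: cc.
move=> y; apply: (@continuous_comp _ _ _ (fun y => dotv (x - y) (x - y)) Num.sqrt).
  exact: cdot.
exact: sqrt_continuous.
Qed.

(** Only the part of [Q] within a fixed Euclidean radius of [x] matters, and
    that part is compact. *)
Lemma closed_proximinal x Q : closed Q -> Q !=set0 ->
  exists2 u, Q u & forall v, Q v -> enorm (x - u) <= enorm (x - v).
Proof.
move=> Qcl [q Qq]; pose r := enorm (x - q).
pose A := Q `&` [set y | enorm (x - y) <= r].
have Acl : closed A.
  apply: closedI => //.
  exact: (continuous_closedP _).1 (@continuous_enormB x) _ (@closed_le _ r).
have Abnd : bounded_set A.
  exists (r + `|x|); split; first exact: num_real.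
  move=> M rM y [_ /= ryx]; apply: le_trans (ltW rM).
  rewrite -[y](subKr x) (le_trans (ler_normB _ _))// addrC lerD2r.
  rewrite /Num.norm/= mx_normrE; apply/bigmax_leP; split.
    exact: enorm_ge0.
  by move=> [i j] _ /=; rewrite ord1 (le_trans (coord_le_enorm _ _)).
have A0 : A !=set0 by exists q; split=> //; exact: lexx.
have [u /[!inE] -[Qu ru] umin] :=
  compact_EVT_min A0 (bounded_closed_compact Abnd Acl)
    (continuous_subspaceT (@continuous_enormB x)).
exists u => // v Qv; have [rv|/ltW rv] := leP (enorm (x - v)) r.
  by apply: umin; rewrite inE.
exact: le_trans ru rv.
Qed.

Lemma dist_le x Q y : Q y -> dist x Q <= enorm (x - y).
Proof.
move=> Qy; apply: ge_inf; last by exists y.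
by exists 0 => _ [z _ <-]; exact: enorm_ge0.
Qed.

Lemma dist_nearest x Q u :
  Q u -> (forall v, Q v -> enorm (x - u) <= enorm (x - v)) ->
  dist x Q = enorm (x - u).
Proof.
move=> Qu umin; apply/eqP; rewrite eq_le dist_le//=.
by apply: lb_le_inf => [|_ [v Qv <-]]; [exists (enorm (x - u)), u | exact: umin].
Qed.

Lemma dist_ge0 x Q : Q !=set0 -> 0 <= dist x Q.
Proof.
move=> [q Qq]; apply: lb_le_inf => [|_ [v _ <-]]; last exact: enorm_ge0.
by exists (enorm (x - q)), q.
Qed.

Lemma dist_triangle x y Q : Q !=set0 -> dist x Q <= enorm (x - y) + dist y Q.
Proof.
move=> [q Qq]; rewrite -lerBlDl; apply: lb_le_inf => [|_ [v Qv <-]].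
  by exists (enorm (y - q)), q.
rewrite lerBlDl; apply: le_trans (dist_le x _ _ Qv) _.
by rewrite -(subrKA y x (- v)) enormD.
Qed.

End EuclideanStructure.

(** * Functions with Lipschitz gradient *)

(** The mean value theorem is applied to [g] minus the quadratic
    [dg 0 * t + K / 2 * t^2], whose derivative is then nonpositive. Applied to
    [g] itself it would lose a factor 2 in front of [K]. *)
Lemma quadratic_upper_bound (R : realType) (g dg : R -> R) (K : R) :
  (forall t : R, is_derive t 1 g (dg t)) ->
  (forall t, 0 <= t -> dg t - dg 0 <= K * t) ->
  g 1 - g 0 <= dg 0 + K / 2.
Proof.
move=> gD dgK.
pose q t : R := g t - (dg 0 * t + K / 2 * t ^+ 2).
have qD (t : R) : is_derive t 1 q (dg t - dg 0 - K * t).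
  apply: is_derive_eq.
  rewrite /GRing.scale /=; lra.
have [|t /[!in_itv]/= /andP[t0 _] q10] :=
  @MVT R q _ 0 1 ltr01 (fun t _ => qD t) _.
  by apply: derivable_within_continuous => t _; exact: ex_derive.
have := dgK t (ltW t0); move: q10; rewrite /q; lra.
Qed.

Section GradientLipschitz.
Context {R : realType} {n : nat} (f : 'rV[R]_n -> R).
Implicit Types (x y u v : 'rV[R]_n) (t : R).

(** [grad f x] is defined by partial derivatives only; differentiability is
    what makes it represent all directional derivatives. *)
Lemma differentiable_derive_grad x v :
  differentiable f x -> 'D_v f x = dotv (grad f x) v.
Proof.
move=> fx; rewrite deriveE// {1}(matrix_sum_delta v) big_ord1 linear_sum/=.
by apply: eq_bigr => i _; rewrite linearZ/= mxE deriveE// mulrC.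
Qed.

Lemma is_derive_line x v t :
  differentiable f (x + t *: v) ->
  is_derive t 1 (fun s => f (x + s *: v)) (dotv (grad f (x + t *: v)) v).
Proof.
move=> fxt.
have lineE : (fun h : R => h^-1 *: (((fun s => f (x + s *: v)) \o shift t)
      (h *: (1 : R)) - f (x + t *: v))) =
    (fun h => h^-1 *: ((f \o shift (x + t *: v)) (h *: v) - f (x + t *: v))).
  apply/funext => h /=; congr (_ *: (f _ - _)).
  by rewrite [h *: 1]mulr1 scalerDl addrCA.
split; last by rewrite /derive lineE; exact: differentiable_derive_grad.
by rewrite /derivable lineE; exact: diff_derivable.
Qed.

Context {L : R} (f_lip : grad_lipschitz f L).

Lemma grad_increment_le x v t : 0 <= t ->
  dotv (grad f (x + t *: v) - grad f x) v <= L * enorm v ^+ 2 * t /\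
  - dotv (grad f (x + t *: v) - grad f x) v <= L * enorm v ^+ 2 * t.
Proof.
move=> t0.
have bnd w : enorm w = enorm (grad f (x + t *: v) - grad f x) ->
    dotv w v <= L * enorm v ^+ 2 * t.
  move=> wE; apply: le_trans (dotv_le_enorm _ _) _; rewrite wE.
  have := f_lip.2 (x + t *: v) x; rewrite addrAC subrr add0r enormZ// => lip.
  by apply: le_trans (ler_wpM2r (enorm_ge0 v) lip) _; rewrite le_eqVlt;
    apply/orP; left; apply/eqP; ring.
by split; [exact: bnd | rewrite -dotvNl; apply: bnd; exact: enormN].
Qed.

(** The descent lemma: [quadratic_upper_bound] along the segment from [x] to
    [x + v]. *)
Lemma descent_upper x v :
  f (x + v) <= f x + dotv (grad f x) v + L / 2 * enorm v ^+ 2.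
Proof.
have := @quadratic_upper_bound R _ _ (L * enorm v ^+ 2)
  (fun t => is_derive_line x v t (f_lip.1 _)).
rewrite !scale1r !scale0r !addr0 => H.
have /H : forall t, 0 <= t ->
    dotv (grad f (x + t *: v)) v - dotv (grad f x) v <= L * enorm v ^+ 2 * t.
  by move=> t /(grad_increment_le x v)[+ _]; rewrite !dotvE.
lra.
Qed.

Lemma descent_lower x v :
  f x + dotv (grad f x) v - L / 2 * enorm v ^+ 2 <= f (x + v).
Proof.
have := @quadratic_upper_bound R (fun t => - f (x + t *: v))
  (fun t => - dotv (grad f (x + t *: v)) v) (L * enorm v ^+ 2)
  (fun t => is_deriveN (is_derive_line x v t (f_lip.1 _))).
rewrite !scale1r !scale0r !addr0 => H.
have /H : forall t, 0 <= t ->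
    - dotv (grad f (x + t *: v)) v - - dotv (grad f x) v <= L * enorm v ^+ 2 * t.
  by move=> t /(grad_increment_le x v)[_]; rewrite !dotvE => +; lra.
lra.
Qed.

(** The step length [1 / L] minimizes the right-hand side of [descent_upper]
    over the multiples of [- grad f x]. *)
Lemma gradient_step_decrease x : 0 < L ->
  f (x - (1 / L) *: grad f x) <= f x - enorm (grad f x) ^+ 2 / (2 * L).
Proof.
move=> L0; apply: le_trans (descent_upper _ _) _.
rewrite !sqr_enorm !dotvE le_eqVlt; apply/orP; left; apply/eqP; field.
by rewrite gt_eqF.
Qed.

(** If the inequality failed by [d > 0], comparing convexity with
    [descent_lower] at [x + t v] would give [d <= t * K] for all [t] in (0, 1],
    although the right-hand side tends to 0 with [t]. *)
Lemma convex_grad_le x y :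
  convex_function [set: 'rV[R]_n] f -> f x + dotv (grad f x) (y - x) <= f y.
Proof.
move=> fcvx; set v := y - x; set c := dotv _ _.
rewrite leNgt; apply/negP => gap.
pose K := L / 2 * enorm v ^+ 2; pose d := f x + c - f y.
have segment t : 0 < t -> t <= 1 -> d <= t * K.
  move=> t0 t1.
  have : f (t *: y + (1 - t) *: x) <= t * f y + (1 - t) * f x :=
    fcvx (Itv01 (ltW t0) t1) y x (mem_set I) (mem_set I).
  have -> : t *: y + (1 - t) *: x = x + t *: v.
    by rewrite /v scalerBr scalerBl scale1r addrCA.
  have := descent_lower x (t *: v); rewrite dotvZr -/c (enormZ _ _ (ltW t0)) exprMn.
  by move=> lower upper; rewrite /d /K -(ler_pM2l t0); lra.
have d0 : 0 < d by rewrite subr_gt0.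
have K0 : 0 < K by have := segment 1 ltr01 (lexx _); lra.
have dK : d <= K by rewrite -[K]mul1r; exact: segment.
(* This [t] makes [t * K] equal to [d / 2]; it is at most 1 by the case
   [t = 1] of [segment]. *)
have K2 : 0 < 2 * K by rewrite mulr_gt0.
have := segment (d / (2 * K)) (divr_gt0 d0 K2).
have -> : d / (2 * K) * K = d / 2 by field; rewrite gt_eqF.
by rewrite ler_pdivrMr// mul1r => small; have := small ltac:(lra); lra.
Qed.

Hypothesis L_gt0 : 0 < L.

(** Subtracting the linearization at [x] leaves a convex function which is
    minimal at [x] and has gradient [e = grad f y - grad f x] at [y]; a gradient
    step from [y] decreases it by [|e|^2 / (2 L)], but not below its minimum. *)
Lemma convex_bregman_lower x y : convex_function [set: 'rV[R]_n] f ->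
  f x + dotv (grad f x) (y - x) + enorm (grad f y - grad f x) ^+ 2 / (2 * L)
    <= f y.
Proof.
move=> fcvx; set e := grad f y - grad f x.
have := convex_grad_le x (y - L^-1 *: e) fcvx.
have := descent_upper y (- (L^-1 *: e)).
rewrite enormN enormZ; last by rewrite invr_ge0 ltW.
move=> upper lower.
have := le_trans lower upper.
have -> : y - L^-1 *: e - x = (y - x) - L^-1 *: e by rewrite addrAC.
rewrite dotvDr !dotvNr !dotvZr.
have -> : dotv (grad f y) e = dotv (grad f x) e + enorm e ^+ 2.
  by rewrite sqr_enorm -dotvDl addrC subrK.
have -> : L / 2 * (L^-1 * enorm e) ^+ 2 = enorm e ^+ 2 / (2 * L).
  by field; rewrite gt_eqF.
have -> : L^-1 * (dotv (grad f x) e + enorm e ^+ 2) =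
    L^-1 * dotv (grad f x) e + 2 * (enorm e ^+ 2 / (2 * L)).
  by field; rewrite gt_eqF.
lra.
Qed.

(** The Baillon-Haddad inequality, the sum of [convex_bregman_lower] for
    [(x, y)] and for [(y, x)]. *)
Lemma grad_cocoercive x y : convex_function [set: 'rV[R]_n] f ->
  enorm (grad f x - grad f y) ^+ 2 / L <= dotv (grad f x - grad f y) (x - y).
Proof.
move=> fcvx.
have := convex_bregman_lower x y fcvx; have := convex_bregman_lower y x fcvx.
rewrite -(enormN (grad f y - _)) opprB -(opprB x y) dotvNr dotvDl dotvNl.
have -> : enorm (grad f x - grad f y) ^+ 2 / L =
    2 * (enorm (grad f x - grad f y) ^+ 2 / (2 * L)).
  by field; rewrite gt_eqF.
lra.
Qed.

Lemma gradient_descent_sublevel (x : nat -> 'rV[R]_n) c k :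
  gradient_descent f (1 / L) x -> sublevel f c (x 0%N) -> sublevel f c (x k).
Proof.
move=> xE x0c; elim: k => // k; apply: le_trans; rewrite xE.
apply: le_trans (gradient_step_decrease _ L_gt0) _.
by rewrite gerBl divr_ge0 ?sqr_ge0// mulr_ge0// ltW.
Qed.

End GradientLipschitz.

(** * The error bound and the convergence rates *)

Section CorrectedErrorBound.
Context {R : realType} {n : nat} (f : 'rV[R]_n -> R).
Context {nu : R} {Omega : set 'rV[R]_n} (f_EB : cor_EB f nu Omega).
Implicit Types (x p : 'rV[R]_n).

Lemma proj_crit_dist {x p} : proj_crit f x p -> dist x (crit f) = enorm (x - p).
Proof. by move=> [fp pmin]; exact: dist_nearest. Qed.

Lemma cor_EB_le {x p} : Omega x -> proj_crit f x p ->
  nu * enorm (x - p) ^+ 2 <= dotv (grad f x) (x - p).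
Proof.
move=> Ox xp; rewrite -lee_fin -(proj_crit_dist xp).
apply: le_trans (f_EB.2 _ Ox) _.
by apply: ereal_inf_lbound; exists p.
Qed.

(** Cauchy-Schwarz and division by [|x - p|], which may vanish. *)
Lemma cor_EB_grad {x p} : Omega x -> proj_crit f x p ->
  nu * enorm (x - p) <= enorm (grad f x).
Proof.
move=> Ox xp; have := le_trans (cor_EB_le Ox xp) (dotv_le_enorm _ _).
have := enorm_ge0 (x - p); rewrite le_eqVlt => /predU1P[<- _|d0].
  by rewrite mulr0 enorm_ge0.
by rewrite expr2 mulrA ler_pM2r.
Qed.

End CorrectedErrorBound.

Theorem corollary5 (R : realType) (n : nat) (f : 'rV[R]_n -> R)
    (L fmin eps : R)
    (L_gt0 : 0 < L)
    (f_lip : grad_lipschitz f L)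
    (f_min : achieves_min f fmin)
    (crit_Argmin : crit f = Argmin f)
    (Argmin_neq0 : Argmin f !=set0)
    (eps_gt0 : 0 < eps) :
  let Omega := sublevel f (fmin + eps) in
  [/\ forall nu : R, cor_EB f nu Omega -> nu < L ->
        forall x : nat -> 'rV[R]_n,
          gradient_descent f (1 / L) x -> Omega (x 0%N) ->
          forall k : nat,
            f (x k.+1) - fmin <= (1 - (nu / L) ^+ 2) * (f (x k) - fmin),
      forall nu : R, cor_EB f nu Omega -> nu < L ->
        convex_function [set: 'rV[R]_n] f ->
        forall x : nat -> 'rV[R]_n,
          gradient_descent f (1 / L) x -> Omega (x 0%N) ->
          forall k : nat,
            dist (x k.+1) (Argmin f) ^+ 2 <=
              (1 - nu / L) * dist (x k) (Argmin f) ^+ 2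
    & forall tau : R, 0 < tau -> tau < 1 ->
        convex_function [set: 'rV[R]_n] f ->
        (forall x : nat -> 'rV[R]_n,
          gradient_descent f (1 / L) x -> Omega (x 0%N) ->
          forall k : nat,
            dist (x k.+1) (Argmin f) ^+ 2 <= tau * dist (x k) (Argmin f) ^+ 2) ->
        cor_EB f (L * (1 - Num.sqrt tau) ^+ 2) Omega].
Proof.
move=> Omega.
have [[xmin fxmin] fmin_le] := f_min.
have crit_fmin p : crit f p -> f p = fmin.
  rewrite crit_Argmin => fp; apply/eqP; rewrite eq_le fmin_le andbT.
  by rewrite -fxmin.
have crit_neq0 : crit f !=set0 by rewrite crit_Argmin.
(* As the set of minimizers, [crit f] is a sublevel set of a continuous
   function. *)
have crit_closed : closed (crit f).
  rewrite (_ : crit f = f @^-1` [set t | t <= fmin]); last first.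
    rewrite crit_Argmin; apply/seteqP; split=> [y fy|y /= fy z].
      by rewrite /= -fxmin.
    exact: le_trans fy (fmin_le z).
  apply: (continuous_closedP _).1 _ _ (@closed_le _ fmin).
  by move=> y; apply: differentiable_continuous; exact: f_lip.1.
have proj_ex x : exists p, proj_crit f x p.
  by have [p fp pmin] := closed_proximinal x _ crit_closed crit_neq0; exists p.
rewrite -crit_Argmin.
have coco x p : convex_function [set: 'rV[R]_n] f -> crit f p ->
    enorm (grad f x) ^+ 2 / L <= dotv (grad f x) (x - p).
  by move=> fcvx fp; have := grad_cocoercive f f_lip L_gt0 x p fcvx;
    rewrite fp subr0.
split.
- move=> nu f_EB _ x xE x0 k; rewrite xE.
  have Ox := gradient_descent_sublevel f f_lip L_gt0 x _ k xE x0.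
  have [p xp] := proj_ex (x k).
  have gap : f (x k) - fmin <= L / 2 * enorm (x k - p) ^+ 2.
    have := descent_upper f f_lip p (x k - p).
    rewrite addrC subrK xp.1 (crit_fmin _ xp.1) -[0](scale0r 0) dotvZl mul0r; lra.
  have nu0 : 0 <= nu := ltW f_EB.1.
  have slope : nu ^+ 2 * enorm (x k - p) ^+ 2 <= enorm (grad f (x k)) ^+ 2.
    rewrite -exprMn ler_sqr ?nnegrE ?mulr_ge0 ?enorm_ge0//.
    exact: (cor_EB_grad f f_EB Ox xp).
  have := gradient_step_decrease f f_lip (x k) L_gt0.
  have : (nu / L) ^+ 2 * (f (x k) - fmin) <= enorm (grad f (x k)) ^+ 2 / (2 * L).
    apply: le_trans (ler_wpM2l (sqr_ge0 _) gap) _.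
    have -> : (nu / L) ^+ 2 * (L / 2 * enorm (x k - p) ^+ 2) =
        nu ^+ 2 * enorm (x k - p) ^+ 2 / (2 * L) by field; rewrite gt_eqF.
    by rewrite ler_pM2r// invr_gt0 mulr_gt0.
  lra.
- move=> nu f_EB _ fcvx x xE x0 k; rewrite xE.
  have Ox := gradient_descent_sublevel f f_lip L_gt0 x _ k xE x0.
  have [p xp] := proj_ex (x k).
  have dist_step : dist (x k - (1 / L) *: grad f (x k)) (crit f) ^+ 2 <=
      enorm (x k - (1 / L) *: grad f (x k) - p) ^+ 2.
    rewrite ler_sqr ?nnegrE ?enorm_ge0 ?dist_ge0//.
    exact: (dist_le _ _ _ xp.1).
  apply: le_trans dist_step _; rewrite (proj_crit_dist f xp).
  rewrite addrAC sqr_enormBZ.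
  set g := grad f (x k); set d := x k - p.
  have EB : nu * enorm d ^+ 2 <= dotv g d := cor_EB_le f f_EB Ox xp.
  have := coco (x k) p fcvx xp.1; rewrite -/g -/d => cocog.
  have : L^-1 * (nu * enorm d ^+ 2) <= L^-1 * dotv g d.
    by rewrite ler_pM2l ?invr_gt0.
  have : L^-1 * (enorm g ^+ 2 / L) <= L^-1 * dotv g d.
    by rewrite ler_pM2l ?invr_gt0.
  rewrite !div1r; lra.
- move=> tau tau0 tau1 fcvx rate.
  have sqrt_lt1 : Num.sqrt tau < 1 by rewrite -sqrtr1 ltr_sqrt.
  split; first by rewrite mulr_gt0 ?exprn_gt0 ?subr_gt0.
  move=> x Ox; apply: le_ereal_inf_tmp => _ [p xp <-]; rewrite lee_fin.
  pose y k := iter k (fun z => z - (1 / L) *: grad f z) x.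
  have := rate y (fun k => erefl) Ox 0%N; rewrite /= => contraction.
  set g := grad f x in contraction *.
  set d := dist x (crit f) in contraction *.
  have d0 : 0 <= d by exact: dist_ge0.
  have dist_step : dist (x - (1 / L) *: g) (crit f) <= Num.sqrt tau * d.
    rewrite -ler_sqr ?nnegrE ?dist_ge0 ?mulr_ge0 ?sqrtr_ge0//.
    by rewrite exprMn sqr_sqrtr// ltW.
  have := dist_triangle x (x - (1 / L) *: g) (crit f) crit_neq0.
  rewrite subKr div1r enormZ; last by rewrite invr_ge0 ltW.
  rewrite -/d -div1r => tri.
  have slope : (1 - Num.sqrt tau) * d <= enorm g / L by lra.
  apply: le_trans (coco x p fcvx xp.1).
  have -> : enorm g ^+ 2 / L = L * (enorm g / L) ^+ 2 by field; rewrite gt_eqF.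
  rewrite -mulrA -exprMn ler_pM2l// ler_sqr ?nnegrE//.
    by rewrite mulr_ge0// subr_ge0 ltW.
  by rewrite divr_ge0 ?enorm_ge0 ?ltW.
Qed.
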